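(* Let $n\ge 2$, $m\ge 1$ and let $Y_1,\dots,Y_n,X_1,\dots,X_m$ be $n+m$ indeterminates over $\mathbb{F}_q$. Write $\Delta:=\Delta_{n+m}(\underline Y,\underline X)$. Put $\delta_i:=(-1)^{i-1}\Delta_{n+m-1}(\underline{\hat Y_i},\underline X)$ for $1\le i\le n$ and $\delta_i:=(-1)^{i-1}\Delta_{n+m-1}(\underline Y,\underline{\hat X_{i-n}})$ for $n+1\le i\le n+m$. Let $A$ be the $(n+m)\times(n+m)$ matrix $$A:=\begin{pmatrix}\mathcal{M}_n(\delta_1,\dots,\delta_n)&\mathcal{M}_{n,m}(\delta_{n+1},\dots,\delta_{n+m})\\ 0&\mathrm{Id}_m\end{pmatrix},$$ with $0\in M_{m,n}(\mathbb{F}_q[\underline Y,\underline X])$, and for $k\ge1$ put $$\alpha_k:=\delta_1^{q^{k+1}}Y_1+\cdots+\delta_n^{q^{k+1}}Y_n+\delta_{n+1}^{q^{k+1}}X_1+\cdots+\delta_{n+m}^{q^{k+1}}X_m .$$ Then $A\;{}^t\mathcal{M}_{n+m}(\underline Y,\underline X)=M$, where $M=[m_{i,j}]_{1\le i,j\le n+m}=\begin{pmatrix} M_1 & M_2 \\ M_3 & M_4 \end{pmatrix}$ is given as follows. The first $n$ rows (blocks $M_1$ of size $n\times n$ and $M_2$ of size $n\times m$) satisfy: $m_{1,j}=0$ for $1\le j\le n+m-1$; $m_{1,n+m}=(-1)^{n+m-1}\Delta$; $m_{2,1}=\Delta$; $m_{2,j}=0$ for $2\le j\le n+m$; and for $3\le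 i\le n$: $m_{i,j}=\alpha_{i-j-1}^{q^{j-1}}$ for $1\le j\le i-2$, $m_{i,i-1}=\Delta^{q^{i-2}}$, and $m_{i,j}=0$ for $i\le j\le n+m$. That is, $$M_1=\begin{pmatrix} 0&\cdot&\cdot&\cdots&\cdot&0&0\\ \Delta&0&\cdot&\cdots&\cdot&0&0\\ \alpha_1&\Delta^q&0&\cdots&\cdot&0&0\\ \alpha_2&\alpha_1^q&\Delta^{q^2}&\cdots&\cdot&0&0\\ \vdots&\vdots&\vdots&\cdots&\cdot&\vdots&\vdots\\ \alpha_{n-2}&\alpha_{n-3}^q&\cdot&\cdots&\alpha_1^{q^{n-3}}&\Delta^{q^{n-2}}&0\end{pmatrix},$$ and $M_2$ has all entries $0$ except its upper right entry, which is $(-1)^{n+m-1}\Delta$. The last $m$ rows are given by $M_3={}^t\mathcal{M}_{n,m}(X_1,\dots,X_m)$ and $M_4={}^t\mathcal{M}_m(X_1^{q^n},\dots,X_m^{q^n})$.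
   Context: $q=p^s$ is a power of a prime $p$. For a commutative ring $R$ containing $\mathbb{F}_q$, integers $k,l\ge1$ and $\underline a=(a_1,\dots,a_l)\in R^l$, the Moore matrix of size $k,l$ is the $k\times l$ matrix $\mathcal{M}_{k,l}(\underline a):=\big(a_j^{q^{i-1}}\big)_{1\le i\le k,\,1\le j\le l}$ (row $i$, column $j$); $\mathcal{M}_l:=\mathcal{M}_{l,l}$, and $\Delta_l(\underline a):=\det\mathcal{M}_l(\underline a)$. $\underline Y=(Y_1,\dots,Y_n)$, $\underline X=(X_1,\dots,X_m)$; $\underline{\hat Y_i}$ (resp. $\underline{\hat X_i}$) is the tuple $\underline Y$ (resp. $\underline X$) with its $i$-th entry omitted; $(\underline Y,\underline X)$ etc. are concatenated tuples. ${}^tN$ is the transpose of $N$. *)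

(* Defs.v *)
From HB Require Import structures.
From mathcomp Require Import all_boot all_order all_algebra all_field.
From mathcomp Require Import mpoly.

Set Implicit Arguments.
Unset Strict Implicit.
Unset Printing Implicit Defensive.

Import GRing.Theory.
Local Open Scope ring_scope.

(* Throughout, F is the finite field with q = #|F| elements, and a commutative
   ring containing it is a commutative (nonzero) F-algebra.  Tuples of ring
   elements are row vectors. *)

(* Rows are numbered from 0, so the exponent q^(i-1) becomes q^i. *)
Definition Moore (F : finFieldType) (R : comAlgType F) (k l : nat)
    (a : 'rV[R]_l) : 'M[R]_(k, l) :=
  \matrix_(i < k, j < l) a 0 j ^+ (#|F| ^ i)%N.

Definition Moore_det (F : finFieldType) (R : comAlgType F) (l : nat)
    (a : 'rV[R]_l) : R :=
  \det (Moore l a).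

Section Construction.

Variables (F : finFieldType) (R : comAlgType F) (n m : nat).
Variables (Y : 'rV[R]_n) (X : 'rV[R]_m).

Local Notation q := #|F|.

Definition Delta : R := Moore_det (row_mx Y X).

(* deltaY is (delta_1, ..., delta_n); with i numbered from 0 its sign
   (-1)^(i-1) becomes (-1)^i.  [col' i Y] is Y with its i-th entry omitted. *)
Definition deltaY : 'rV[R]_n :=
  \row_(i < n) ((-1) ^+ i * Moore_det (row_mx (col' i Y) X)).

(* deltaX is (delta_(n+1), ..., delta_(n+m)). *)
Definition deltaX : 'rV[R]_m :=
  \row_(i < m) ((-1) ^+ (n + i)%N * Moore_det (row_mx Y (col' i X))).

Definition matA : 'M[R]_(n + m) :=
  block_mx (Moore n deltaY) (Moore n deltaX) 0 1%:M.

Definition alpha (k : nat) : R :=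
  \sum_(i < n) deltaY 0 i ^+ (q ^ k.+1)%N * Y 0 i
  + \sum_(i < m) deltaX 0 i ^+ (q ^ k.+1)%N * X 0 i.

(* The entry m_(i,j) of the first n rows, with i and j numbered from 1;
   only used for 1 <= i <= n and 1 <= j <= n + m. *)
Definition top_entry (i j : nat) : R :=
  if i == 1%N then
    if j == (n + m)%N then (-1) ^+ (n + m - 1)%N * Delta else 0
  else if i == 2%N then
    if j == 1%N then Delta else 0
  else if (j <= i - 2)%N then alpha (i - j - 1) ^+ (q ^ (j - 1))%N
  else if j == (i - 1)%N then Delta ^+ (q ^ (i - 2))%N
  else 0.

Definition matM : 'M[R]_(n + m) :=
  block_mx
    (\matrix_(i < n, j < n) top_entry i.+1 j.+1)
    (\matrix_(i < n, j < m) top_entry i.+1 (n + j.+1))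
    (Moore n X)^T
    (Moore m (\row_(j < m) X 0 j ^+ (q ^ n)%N))^T.

End Construction.

(* Main.v *)
Require Import Defs.
From HB Require Import structures.
From mathcomp Require Import all_boot all_order all_algebra all_field.
From mathcomp Require Import mpoly zify.

Set Implicit Arguments.
Unset Strict Implicit.
Unset Printing Implicit Defensive.

Import GRing.Theory.
Local Open Scope ring_scope.

(* All entries of the first n rows of the product are pairings
   S(i, j) = sum_k delta_k^(q^i) Z_k^(q^j), where Z = (Y, X).  The q-Frobenius
   is a ring morphism, so S(i + e, j + e) = S(i, j)^(q^e), which leaves only the
   entries with i = 0 or j = 0.  The delta_k are, up to a global sign, the
   cofactors of the last row of the Moore matrix of Z, so S(0, j) is a Laplace
   expansion: the determinant with its last row replaced by row j.  The
   delta_k^q are the cofactors of the first row, whence S(1, 0) = Delta. *)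

Section QFrobenius.

Variables (F : finFieldType) (R : comAlgType F).

Lemma card_pchar_nat : [pchar R].-nat #|F|.
Proof.
have [p p_pr pF] := finPcharP F.
have pR : p \in [pchar R] by rewrite (pchar_lalg R).
by rewrite (eq_pnat _ (pcharf_eq pR)) (card_pprimeChar pF) pnatX pnat_id.
Qed.

(** Convertible to the powers in [Moore]; a named function can carry the ring morphism instances. *)
Definition qfrob (k : nat) (x : R) : R := x ^+ (#|F| ^ k)%N.

Fact qfrob_is_nmod_morphism k : nmod_morphism (qfrob k).
Proof.
split=> [|x y]; first by rewrite /qfrob expr0n expn_eq0 -leqn0 leqNgt (cardD1 0).
by rewrite /qfrob exprDn_pchar // pnatX card_pchar_nat.
Qed.

Fact qfrob_is_monoid_morphism k : monoid_morphism (qfrob k).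
Proof. by split=> [|x y]; rewrite /qfrob ?expr1n ?exprMn. Qed.

HB.instance Definition _ k :=
  GRing.isNmodMorphism.Build R R (qfrob k) (qfrob_is_nmod_morphism k).
HB.instance Definition _ k :=
  GRing.isMonoidMorphism.Build R R (qfrob k) (qfrob_is_monoid_morphism k).

Lemma qfrob_comp i j x : qfrob i (qfrob j x) = qfrob (j + i) x.
Proof. by rewrite /qfrob -exprM -expnD. Qed.

End QFrobenius.

Section MooreCofactors.

Variables (F : finFieldType) (R : comAlgType F).

(** Omitting an entry before or after concatenation gives sizes such as [n.-1 + m] and [(n + m).-1],
    equal but not convertible. *)
Lemma eq_Moore_det k l (a : 'rV[R]_k) (b : 'rV[R]_l) : k = l ->
  (forall (i : 'I_k) (j : 'I_l), i = j :> nat -> a 0 i = b 0 j) ->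
  Moore_det a = Moore_det b.
Proof.
move=> ekl; case: l / ekl b => b eab.
by congr Moore_det; apply/rowP => i; apply: eab.
Qed.

Variables (N : nat) (Z : 'rV[R]_N).

Definition Moore_delta (k : 'I_N) : R := (-1) ^+ k * Moore_det (col' k Z).

Definition Moore_pairing (i j : nat) : R :=
  \sum_(k < N) qfrob i (Moore_delta k) * qfrob j (Z 0 k).

Lemma Moore_pairing_shift e i j :
  Moore_pairing (i + e) (j + e) = qfrob e (Moore_pairing i j).
Proof.
rewrite rmorph_sum; apply: eq_bigr => k _.
by rewrite rmorphM /= !qfrob_comp.
Qed.

Lemma Moore_pairing0 (l : 'I_N) j : l.+1 = N ->
  Moore_pairing 0 j =
    (-1) ^+ l * \det (\matrix_(i, k) qfrob (if i == l then j else i) (Z 0 k)).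
Proof.
move=> lN; rewrite (expand_det_row _ l) mulr_sumr; apply: eq_bigr => k _.
rewrite mxE eqxx [RHS]mulrCA mulrC; congr (_ * _).
(* The cofactor sign [(-1) ^+ (l + k)] times the global [(-1) ^+ l] is the sign of [Moore_delta]. *)
rewrite /cofactor mulrA -exprD addnA addnn exprD -mul2n exprM sqrrN expr1n.
rewrite expr1n mul1r {1}/qfrob expn0 expr1; congr (_ * \det _).
(* Deleting the last row does not renumber the others, so the minor is a Moore matrix again. *)
apply/matrixP => i h; rewrite !mxE eq_sym (negbTE (neq_lift l i)).
congr (_ ^+ (_ ^ _)); rewrite /= /bump leqNgt.
by have -> : (i < l)%N by move: (ltn_ord i); rewrite -[X in (_ < X.-1)%N]lN.
Qed.

(** Row [j] then occurs twice, at its own place and as the last row. *)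
Lemma Moore_pairing0_lt j : (j < N.-1)%N -> Moore_pairing 0 j = 0.
Proof.
move=> jN; have N0 : (0 < N)%N by case: (N) jN.
have lN : (N.-1 < N)%N by rewrite prednK.
have jN' : (j < N)%N by apply: ltn_trans lN.
rewrite (@Moore_pairing0 (Ordinal lN)) ?prednK //.
rewrite (@determinant_alternate _ _ _ (Ordinal jN') (Ordinal lN)) ?mulr0 //.
  by rewrite -val_eqE /= ltn_eqF.
by move=> k; rewrite !mxE eqxx -val_eqE /= ltn_eqF.
Qed.

Lemma Moore_pairing0_last : (0 < N)%N ->
  Moore_pairing 0 N.-1 = (-1) ^+ N.-1 * Moore_det Z.
Proof.
move=> N0; have lN : (N.-1 < N)%N by rewrite prednK.
rewrite (@Moore_pairing0 (Ordinal lN)) ?prednK //; congr (_ * \det _).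
by apply/matrixP => i k; rewrite !mxE; case: eqP => [->|].
Qed.

Lemma Moore_pairing10 : (0 < N)%N -> Moore_pairing 1 0 = Moore_det Z.
Proof.
move=> N0; rewrite /Moore_det (expand_det_row _ (Ordinal N0)).
apply: eq_bigr => k _; rewrite mxE mulrC; congr (_ * _).
rewrite rmorphM rmorphXn rmorphN1 /cofactor /= add0n; congr (_ * _).
(* Without its first row the matrix is the entrywise q-th power of a Moore matrix, and [\det]
   commutes with ring morphisms. *)
rewrite -det_map_mx; congr (\det _); apply/matrixP => i h.
by rewrite !mxE /= /qfrob -exprM -expnD addn1.
Qed.

End MooreCofactors.

Section Product.

Variables (F : finFieldType) (R : comAlgType F) (n m : nat).
Variables (Y : 'rV[R]_n) (X : 'rV[R]_m).

Local Notation Z := (row_mx Y X).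

Lemma deltaYE i : deltaY Y X 0 i = Moore_delta Z (lshift m i).
Proof.
rewrite mxE; congr (_ * _); apply: eq_Moore_det => [|j h ejh].
  by have := ltn_ord i; lia.
have ilt := ltn_ord i; rewrite !mxE.
(* Omitting an entry of [Y] moves the boundary between [Y] and [X] to [n.-1] on both sides, so the
   mixed cases are contradictory. *)
case: splitP => j' ej; case: splitP => h' /= eh; rewrite ?mxE.
- by congr (Y 0 _); apply: val_inj; rewrite /= -eh -ejh ej.
- by exfalso; move: eh (ltn_ord j'); rewrite /bump; case: leqP; lia.
- by exfalso; move: eh (ltn_ord h'); rewrite /bump; case: leqP; lia.
- by congr (X 0 _); apply: val_inj; move: eh; rewrite /= /bump;
    case: leqP; lia.
Qed.

Lemma deltaXE i : deltaX Y X 0 i = Moore_delta Z (rshift n i).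
Proof.
rewrite mxE; congr (_ * _); apply: eq_Moore_det => [|j h ejh].
  by have := ltn_ord i; lia.
have ilt := ltn_ord i; rewrite !mxE.
(* The omitted position is now at least [n], so the boundary stays at [n]. *)
case: splitP => j' ej; case: splitP => h' /= eh; rewrite ?mxE.
- by congr (Y 0 _); apply: val_inj; move: eh (ltn_ord j');
    rewrite /= /bump; case: leqP; lia.
- by exfalso; move: eh (ltn_ord j'); rewrite /bump; case: leqP; lia.
- by exfalso; move: eh (ltn_ord h'); rewrite /bump; case: leqP; lia.
- by congr (X 0 _); apply: val_inj; move: eh; rewrite /= /bump;
    case: leqP; case: leqP; lia.
Qed.

Lemma Moore_pairing_row_mx i j :
  Moore_pairing Z i j =
    \sum_(k < n) qfrob i (deltaY Y X 0 k) * qfrob j (Y 0 k)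
    + \sum_(k < m) qfrob i (deltaX Y X 0 k) * qfrob j (X 0 k).
Proof.
rewrite /Moore_pairing big_split_ord; congr (_ + _); apply: eq_bigr => k _.
  by rewrite deltaYE row_mxEl.
by rewrite deltaXE row_mxEr.
Qed.

Lemma alphaE k : alpha Y X k = Moore_pairing Z k.+1 0.
Proof. by rewrite Moore_pairing_row_mx. Qed.

Lemma Moore_pairing_top_entry i j : (1 < n + m)%N -> (j < n + m)%N ->
  Moore_pairing Z i j = top_entry Y X i.+1 j.+1.
Proof.
move=> nm1 jnm; rewrite /top_entry.
have nm0 : (0 < n + m)%N by apply: ltnW.
(* On and above the diagonal, an entry shifts back to row 0 and vanishes unless its offset [d] is
   [(n + m).-1], which only the top right corner attains. *)
have zero e d : (d < (n + m).-1)%N -> Moore_pairing Z e (d + e) = 0.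
  by move=> dnm; rewrite -[e in LHS]add0n Moore_pairing_shift
    Moore_pairing0_lt // rmorph0.
case: i => [|[|i]] /=.
- case: eqP => ej; last by rewrite Moore_pairing0_lt //; lia.
  by rewrite subn1 -Moore_pairing0_last //; congr (Moore_pairing Z _ _); lia.
- case: j jnm => [|j] jnm /=; first exact: Moore_pairing10.
  by rewrite -[j.+1]addn1 zero //; lia.
rewrite !subSS !subn0 subn1 ltnS; case: leqP => [ji|ij].
  (* Shifting back by [j] lands in column 0 at row [i.+2 - j], which is at least 2: an [alpha]. *)
  rewrite alphaE -/(qfrob j _) -Moore_pairing_shift add0n.
  by congr (Moore_pairing Z _ _); lia.
case: eqP => [[->]|ji].
  by rewrite -/(qfrob i.+1 _) /Delta -Moore_pairing10 // -Moore_pairing_shift.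
by rewrite -[j](@subnK i.+2) ?zero //; lia.
Qed.

Lemma matA_mul_tr_Moore : (1 < n + m)%N ->
  matA Y X *m (Moore (n + m) Z)^T = matM Y X.
Proof.
move=> nm1; have eMoore : (Moore (n + m) Z)^T =
    block_mx (Moore n Y)^T (\matrix_(i, j) qfrob (n + j) (Y 0 i))
      (Moore n X)^T (Moore m (\row_j qfrob n (X 0 j)))^T.
  apply/matrixP => i j; rewrite [LHS]mxE [LHS]mxE.
  rewrite -[i]splitK -[j]splitK.
  case: (split i) => i'; case: (split j) => j' /=;
    rewrite ?row_mxEl ?row_mxEr ?block_mxEul ?block_mxEur ?block_mxEdl
      ?block_mxEdr !mxE //.
  by rewrite /qfrob -exprM -expnD.
(* The blocks 0 and 1 of [matA] copy the lower half unchanged; only the two top blocks remain. *)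
rewrite /matA eMoore mulmx_block !mul0mx !mul1mx !add0r.
congr block_mx; apply/matrixP => i j.
  rewrite !mxE -Moore_pairing_top_entry ?(ltn_addr _ (ltn_ord j)) // Moore_pairing_row_mx.
  by congr (_ + _); apply: eq_bigr => k _; rewrite !mxE.
rewrite !mxE addnS -Moore_pairing_top_entry ?ltn_add2l // Moore_pairing_row_mx.
by congr (_ + _); apply: eq_bigr => k _; rewrite !mxE -?qfrob_comp.
Qed.

End Product.

Theorem theorem4p3 (F : finFieldType) (n m : nat)
    (hn : (2 <= n)%N) (hm : (1 <= m)%N) :
  let Y : 'rV[{mpoly F[n + m]}]_n := \row_(i < n) 'X_(lshift m i) in
  let X : 'rV[{mpoly F[n + m]}]_m := \row_(j < m) 'X_(rshift n j) in
  matA Y X *m (Moore (n + m) (row_mx Y X))^T = matM Y X.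
Proof. by move=> Y X; apply: matA_mul_tr_Moore; apply: ltn_addr. Qed.
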